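(* Let $H=\mathbb{C}^2$ with inner product $\langle(\lambda_1,\lambda_2)|(\mu_1,\mu_2)\rangle=\lambda_1\overline{\mu_1}+\lambda_2\overline{\mu_2}$ and triple product $\{\lambda,\mu,\nu\}=\frac12\big(\langle\lambda|\mu\rangle\nu+\langle\nu|\mu\rangle\lambda\big)$, regarded as a real JB$^*$-triple by restricting scalars to $\mathbb{R}$. Let $T:H\to H$ be the real linear map $T(\lambda_1,\lambda_2)=(\mathrm{Re}(\lambda_2),-\mathrm{Re}(\lambda_1))$. Then $T$ is a local triple derivation on $H$, but $T$ is not a triple derivation.
   Context: A triple derivation on a real JB$^*$-triple $E$ (with triple product $\{\cdot,\cdot,\cdot\}$) is a real linear map $\delta:E\to E$ with $\delta\{a,b,c\}=\{\delta(a),b,c\}+\{a,\delta(b),c\}+\{a,b,\delta(c)\}$ for all $a,b,c\in E$. A local triple derivation on $E$ is a real linear map $T:E\to E$ such that for each $a\in E$ there is a triple derivation $\delta_a$ on $E$ with $T(a)=\delta_a(a)$. The triple $H$ above is a rank-one complex Cartan factor of type $I^{\mathbb{C}}$. *)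

(* Defs.v *)
From HB Require Import structures.
From mathcomp Require Import all_boot all_order all_algebra.
From mathcomp Require Import complex reals.

Set Implicit Arguments.
Unset Strict Implicit.
Unset Printing Implicit Defensive.

Import GRing.Theory Num.Theory.
Local Open Scope ring_scope.
Local Open Scope complex_scope.

(* A triple derivation involves only the underlying real vector space of a real
   JB*-triple and its triple product [tp], so these are the only parameters. *)
Definition triple_derivation (R : realType) (E : lmodType R)
    (tp : E -> E -> E -> E) (delta : E -> E) : Prop :=
  linear delta /\
  forall a b c : E,
    delta (tp a b c) = tp (delta a) b c + tp a (delta b) c + tp a b (delta c).

Definition local_triple_derivation (R : realType) (E : lmodType R)
    (tp : E -> E -> E -> E) (T : E -> E) : Prop :=
  linear T /\
  forall a : E, exists delta : E -> E,
    triple_derivation tp delta /\ T a = delta a.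

(* The complex vector space C^2, with its canonical R[i]-module structure. *)
Definition C2 (R : realType) : lmodType R[i] := (R[i] * R[i])%type.

(* C^2 with scalars restricted to the reals: [Rcomplex R] is the library's copy
   of R[i] carrying the R-module structure, so that [C2 R] and [C2real R] have
   the same (convertible) carrier but different scalars. *)
Definition C2real (R : realType) : lmodType R := (Rcomplex R * Rcomplex R)%type.

Lemma C2real_scaleE (R : realType) (k : R) (x : C2real R) :
  (k *: x : C2real R) = (k%:C *: (x : C2 R) : C2 R).
Proof.
case: x => [[a b] [c d]].
by congr pair; rewrite /GRing.scale /= /GRing.mul /= !mul0r subr0 addr0.
Qed.

(* Linear in the first variable, conjugate-linear in the second. *)
Definition inner2 (R : realType) (l m : C2 R) : R[i] :=
  l.1 * (m.1)^* + l.2 * (m.2)^*.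

Definition triple2 (R : realType) (l m n : C2 R) : C2 R :=
  2%:R^-1 *: (inner2 l m *: n + inner2 n m *: l).

Definition triple2real (R : realType) : C2real R -> C2real R -> C2real R -> C2real R :=
  @triple2 R.

Definition T2 (R : realType) (l : C2real R) : C2real R :=
  ((complex.Re l.2)%:C, (- complex.Re l.1)%:C).

(* Main.v *)
(** A complex-linear skew-Hermitian operator of C^2 is a triple derivation, and a
    nonzero vector [a] is sent to [b] by such an operator as soon as
    Re <b|a> = 0, which holds for b = T a.  However T kills (i, 0) and not (1, 0),
    and the Leibniz rule fails at ((1,0), (1,0), (i,0)). *)
Require Import Defs.
From mathcomp Require Import all_boot all_order all_algebra.
From mathcomp Require Import complex reals.
From mathcomp Require Import ring lra.

Import Order.TTheory GRing.Theory Num.Theory.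
Local Open Scope ring_scope.
Local Open Scope complex_scope.

(** The general skew-Hermitian matrix, with rows (ip, u + iv) and (-u + iv, ir). *)
Definition skew2 {R : realType} (p r u v : R) (l : C2real R) : C2real R :=
  let: (a +i* b, c +i* d) := l in
  ((u * c - v * d - p * b) +i* (u * d + v * c + p * a),
   (- u * a - v * b - r * d) +i* (v * a - u * b + r * c)).

Lemma triple2realE {R : realType} (a b c d a' b' c' d' e f g h : R) :
  let xr := a * a' + b * b' + c * c' + d * d' in
  let xi := b * a' - a * b' + d * c' - c * d' in
  let yr := e * a' + f * b' + g * c' + h * d' in
  let yi := f * a' - e * b' + h * c' - g * d' in
  @triple2real R (a +i* b, c +i* d) (a' +i* b', c' +i* d') (e +i* f, g +i* h) =
  ((2^-1 * (xr * e - xi * f + yr * a - yi * b))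
     +i* (2^-1 * (xr * f + xi * e + yr * b + yi * a)),
   (2^-1 * (xr * g - xi * h + yr * c - yi * d))
     +i* (2^-1 * (xr * h + xi * g + yr * d + yi * c))).
Proof.
have half : (2%:R^-1 : R[i]) = (2^-1 : R)%:C.
  by rewrite -[2%:R](rmorph_nat (real_complex R)) -fmorphV.
have tpE (l m n : C2 R) : triple2 l m n =
    (2^-1%:C * (inner2 l m * n.1 + inner2 n m * l.1),
     2^-1%:C * (inner2 l m * n.2 + inner2 n m * l.2)).
  by rewrite -half.
rewrite /triple2real tpE /inner2 /=; simpc => /=.
congr (_ +i* _, _ +i* _); ring.
Qed.

(** Such an A is complex-linear with <Ax|y> + <x|Ay> = 0, so the Leibniz rule holds for each term
    <x|y>z. *)
Lemma skew2_triple_derivation {R : realType} (p r u v : R) :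
  triple_derivation (@triple2real R) (skew2 p r u v).
Proof.
split.
  move=> k [[a b] [c d]] [[a' b'] [c' d']].
  congr (_ +i* _, _ +i* _) => /=; ring.
move=> [[a b] [c d]] [[a' b'] [c' d']] [[e f] [g h]].
rewrite !triple2realE /=.
congr (_ +i* _, _ +i* _) => /=; ring.
Qed.

Lemma T2_linear {R : realType} : linear (@T2 R).
Proof.
move=> k [[a b] [c d]] [[a' b'] [c' d']].
congr (_ +i* _, _ +i* _) => /=; ring.
Qed.

(* The operator is J + iH with J (x, y) = (y, -x).  For l = (a + ib, c + id) one
   has T l - J l = iw with w = (-d, b), and k = <w|l> is real, so the Hermitian
   H = (w l^* + l w^* ) / n - k l l^* / n^2, n = |l|^2, satisfies H l = w. *)
Lemma T2_eq_skew2 {R : realType} (l : C2real R) :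
  exists p r u v : R, T2 l = skew2 p r u v l.
Proof.
case: l => [[a b] [c d]].
pose n := a ^+ 2 + b ^+ 2 + c ^+ 2 + d ^+ 2.
have [n0|nN0] := eqVneq n 0.
  exists 0, 0, 0, 0.
  have a0 : a = 0 by apply/eqP; rewrite -sqrf_eq0; apply/eqP; rewrite /n in n0; nra.
  have c0 : c = 0 by apply/eqP; rewrite -sqrf_eq0; apply/eqP; rewrite /n in n0; nra.
  rewrite /T2 /= a0 c0.
  by congr (_ +i* _, _ +i* _) => /=; ring.
pose k := b * c - d * a.
(* The entries of J + iH: p = H11, r = H22 and (u - 1) + iv = i H12. *)
exists (- 2 * d * a / n - k * (a ^+ 2 + b ^+ 2) / n ^+ 2).
exists (2 * b * c / n - k * (c ^+ 2 + d ^+ 2) / n ^+ 2).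
exists (1 - (b ^+ 2 + d ^+ 2) / n + k ^+ 2 / n ^+ 2).
exists ((a * b - c * d) / n - k * (a * c + b * d) / n ^+ 2).
rewrite /T2 /k; rewrite /n in nN0 *.
by congr (_ +i* _, _ +i* _) => /=; field.
Qed.

Theorem mainTheorem2 (R : realType) :
  local_triple_derivation (@triple2real R) (@T2 R) /\
  ~ triple_derivation (@triple2real R) (@T2 R).
Proof.
split.
  split; first exact: T2_linear.
  move=> l; have [p [r [u [v Tl]]]] := T2_eq_skew2 l.
  by exists (skew2 p r u v); split=> //; apply: skew2_triple_derivation.
case=> _ /(_ (1 +i* 0, 0 +i* 0) (1 +i* 0, 0 +i* 0) (0 +i* 1, 0 +i* 0)).
(* The left side is T (i, 0) = 0, the right side (0, -i/2); the last real coordinate shows it. *)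
rewrite !triple2realE /T2 /= => -[_ _ _].
lra.
Qed.
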